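(* Suppose that $F(x;p)$ is a real polynomial system with variables $x\in\mathbb{R}^N$ and parameters $p\in\mathbb{R}^P$. Let $b\in\mathbb{R}^P$ be such that $F(x;b)=0$ has $R>0$ nonsingular isolated real solutions, and let $U_R\subset\mathbb{R}^P$ be a connected open set containing $b$ such that the number of nonsingular isolated real solutions of $F(x;p^* )=0$ is equal to $R$ for all $p^*\in U_R$. If the fundamental group of $U_R$ is trivial, then the corresponding real monodromy group (of $F$ with base point $b$, formed from loops in $U_R$) is $\{(1)\}\subset\mathcal{S}_R$. In particular, if $P=1$, then the corresponding real monodromy group is $\{(1)\}\subset\mathcal{S}_R$.
   Context: A real polynomial system $F(x;p)$ is a finite collection of polynomials with real coefficients in the variables $x\in\mathbb{R}^N$ and the parameters $p\in\mathbb{R}^P$. For fixed $p^*\in\mathbb{R}^P$, a real solution $x^*\in\mathbb{R}^N$ of $F(x;p^* )=0$ is isolated if it is the only solution in some neighborhood of $x^*$, and nonsingular if the Jacobian matrix of $F$ with respect to $x$ has rank $N$ at $(x^*;p^* )$. $\mathcal{S}_R$ denotes the symmetric group on $R$ elements and $(1)$ denotes its identity element. Real monodromy group: with $b$, $R$ and $U_R$ as in the claim, let $x^{(1)},\dots,x^{(R)}\in\mathbb{R}^N$ be the nonsingular isolated real solutions of $F(x;b)=0$. Each loop $\gamma\subset U_R$ starting and ending at $b$ generates a permutation $\sigma_\gamma\in\mathcal{S}_R$, where $\sigma_\gamma(i)=j$ provided that the solution path of $F(x;p)=0$ over $\gamma$ (the continuous path of nonsingular isolated real solutions as $p$ moves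 along $\gamma$) starting at $x^{(i)}$ ends at $x^{(j)}$. The real monodromy group of $F$ with base point $b$ is the collection of all such permutations, $$\{\sigma_\gamma\in\mathcal{S}_R \mid \gamma\subset U_R \text{ is a loop starting and ending at } b\}.$$
   Formalization: For the first claim, when F has more polynomials than variables, it is explicitly assumed that every loop in U_R based at b generates a permutation; without this the definition of the real monodromy group can break down and the claim can fail. *)

(* Defs.v *)
From HB Require Import structures.
From mathcomp Require Import all_boot all_order all_algebra all_fingroup.
From mathcomp Require Import all_classical all_reals all_analysis.
(* mpoly is not imported: its notations clash with those of MathComp-Analysis. *)
From mathcomp.multinomials Require mpoly.

Set Implicit Arguments.
Unset Strict Implicit.
Unset Printing Implicit Defensive.

Import Order.TTheory GRing.Theory Num.Theory.
Import numFieldNormedType.Exports.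

Local Open Scope classical_set_scope.
Local Open Scope ring_scope.

(* M polynomials in N + P indeterminates: the first N are the variables x and
   the last P are the parameters p. *)
Definition poly_system (R : realType) (M N P : nat) : Type :=
  'I_M -> mpoly.mpoly (N + P) R.

Definition peval (R : realType) (N P : nat) (f : mpoly.mpoly (N + P) R)
    (x : 'rV[R]_N) (p : 'rV[R]_P) : R :=
  mpoly.meval (fun i => row_mx x p 0 i) f.

Section Solutions.
Variables (R : realType) (M N P : nat) (F : poly_system R M N P).

Definition is_solution (p : 'rV[R]_P) (x : 'rV[R]_N) : Prop :=
  forall i : 'I_M, peval (F i) x p = 0.

Definition jacobian_x (p : 'rV[R]_P) (x : 'rV[R]_N) : 'M[R]_(M, N) :=
  \matrix_(i < M, j < N) peval (mpoly.mderiv (lshift P j) (F i)) x p.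

Definition isolated_solution (p : 'rV[R]_P) (x : 'rV[R]_N) : Prop :=
  is_solution p x /\ \forall y \near x, is_solution p y -> y = x.

Definition nonsingular_solution (p : 'rV[R]_P) (x : 'rV[R]_N) : Prop :=
  is_solution p x /\ \rank (jacobian_x p x) = N.

Definition nonsing_isolated (p : 'rV[R]_P) : set 'rV[R]_N :=
  [set x | nonsingular_solution p x /\ isolated_solution p x].

End Solutions.

Section Loops.
Variables (R : realType) (P : nat) (U : set 'rV[R]_P) (b : 'rV[R]_P).

(* Paths are total functions on R of which only the values on [0, 1] matter. *)
Definition is_loop (g : R -> 'rV[R]_P) : Prop :=
  [/\ {within `[0, 1]%classic, continuous g},
      (forall t, t \in `[0, 1] -> U (g t)),
      g 0 = b & g 1 = b].

Definition loop_homotopic (g h : R -> 'rV[R]_P) : Prop :=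
  exists H : R * R -> 'rV[R]_P,
    [/\ {within `[0, 1]%classic `*` `[0, 1]%classic, continuous H},
        (forall s t, s \in `[0, 1] -> t \in `[0, 1] -> U (H (s, t))),
        (forall t, t \in `[0, 1] -> H (0, t) = g t /\ H (1, t) = h t) &
        (forall s, s \in `[0, 1] -> H (s, 0) = b /\ H (s, 1) = b)].

Definition homotopy_class (g : R -> 'rV[R]_P) : set (R -> 'rV[R]_P) :=
  [set h | is_loop h /\ loop_homotopic g h].

(* Underlying set of pi_1(U, b); its identity element is the class of the
   constant loop. *)
Definition fundamental_group : set (set (R -> 'rV[R]_P)) :=
  [set homotopy_class g | g in is_loop].

Definition trivial_fundamental_group : Prop :=
  fundamental_group = [set homotopy_class (fun=> b)].

End Loops.

Section Monodromy.
Variables (R : realType) (M N P r : nat) (F : poly_system R M N P).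

Definition solution_path (g : R -> 'rV[R]_P) (z : R -> 'rV[R]_N) : Prop :=
  {within `[0, 1]%classic, continuous z} /\
  forall t, t \in `[0, 1] -> nonsing_isolated F (g t) (z t).

Definition generates (x : 'I_r -> 'rV[R]_N) (g : R -> 'rV[R]_P) (s : 'S_r) :
    Prop :=
  forall i : 'I_r,
    exists z, [/\ solution_path g z, z 0 = x i & z 1 = x (s i)].

Definition every_loop_generates (U : set 'rV[R]_P) (b : 'rV[R]_P)
    (x : 'I_r -> 'rV[R]_N) : Prop :=
  forall g, is_loop U b g -> exists s : 'S_r, generates x g s.

(* The loops that generate no permutation, which may exist if N < M (see
   every_loop_generates), do not contribute. For instance, with complex x and p
   written in real coordinates, the system
     (x^2 - p)(x-1)(x-2), (x^2 - p)(x-1)p, (x^2 - p)(x-2)p, (x^2 - p)p^2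
   has exactly two nonsingular isolated solutions for every p (x = 1, 2 if
   p = 0 and the square roots of p otherwise), no loop through p = 0 lifts, and
   a loop around p = 0 exchanges the two solutions although R^2 is simply
   connected. *)
Definition real_monodromy_group (U : set 'rV[R]_P) (b : 'rV[R]_P)
    (x : 'I_r -> 'rV[R]_N) : set 'S_r :=
  [set s | exists g, is_loop U b g /\ generates x g s].

End Monodromy.

(* Main.v *)
Require Import Defs.
From HB Require Import structures.
From mathcomp Require Import all_boot all_order all_algebra all_fingroup.
From mathcomp Require Import all_classical all_reals all_analysis.
From mathcomp.multinomials Require mpoly.
From mathcomp Require Import ring lra.
Import -(notations) mpoly.
Import Order.TTheory GRing.Theory Num.Theory.
Import numFieldNormedType.Exports.
Local Open Scope classical_set_scope.
Local Open Scope ring_scope.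
Set Implicit Arguments.
Unset Strict Implicit.
Unset Printing Implicit Defensive.

(** Over the relevant part of the parameter space the set of pairs (p, x), with
    x a nonsingular isolated solution at p, is a covering with r sheets.  The
    monodromy of a covering is invariant under homotopies fixing the base point,
    and a constant loop permutes nothing.

    Two properties of the solution sets replace the notion of a covering.  The
    first is separation: near a solution (p, x), each nearby parameter has at
    most one solution near x.  It holds because a left inverse of the Jacobian
    matrix turns the system into a map whose strict derivative in x is the
    identity ([values_preconditioned], [nonsingular_separates]); it makes a lift
    of a path determined by one of its values ([lift_unique]).  The second is
    persistence: the solutions at p move to solutions at nearby parameters.
    Since the number of solutions is constantly r, these are then all the
    solutions nearby ([sheets_exhaust]).

    Separation holds for every system; persistence has three sources.
    - If there are as many equations as variables, it is the implicit function
      theorem ([implicit_function]).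
    - If there are more equations than variables, it comes from the hypothesis
      that every loop generates a permutation.  If a solution at p failed to
      persist along parameters tending to p, a single loop could be drawn
      through all of them and through p ([path_through_sequence]); it lifts r
      times, and by compactness r distinct lifts force persistence on the image
      of the loop ([lifts_persistent], [loops_persistent]).
    - If there is one parameter, only the image of the given loop matters, and
      there the same compactness argument applies to the lifts that define the
      permutation of that loop.

    Over a compact set on which both properties hold, they hold uniformly.  Thus
    a lift of a path can be copied onto any sufficiently close path, without
    moving the endpoints if the paths share theirs ([lift_nearby]).  Along a
    homotopy H, the property that some lift of H(s, _) joins z 0 to z 1 is
    therefore locally constant in s, and for the constant path at the end it
    says z 0 = z 1 ([lift_homotopy]).  If the fundamental group is trivial the
    homotopy is given; if there is one parameter, the image of the loop is an
    interval, inside which the loop contracts linearly to b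
    ([rV1_path_convex]). *)

(** * Metric and topological preliminaries *)

Lemma near_dist (R : realType) (T : topologicalType) (V : normedModType R)
    (f : T -> V) t e :
  {for t, continuous f} -> 0 < e -> \forall t' \near t, `|f t' - f t| < e.
Proof.
by move=> /cvgrPdist_lt + e0 => /(_ e e0); apply: filterS => u; rewrite distrC.
Qed.

Lemma near_ball (R : realType) (V : normedModType R) (v : V) e :
  0 < e -> \forall w \near v, `|w - v| < e.
Proof. by move=> e0; apply: (near_dist (f := id)) => //; exact: cvg_id. Qed.

Lemma closed_dist_le (R : realType) (V : normedModType R) (x : V) r :
  closed [set y : V | `|y - x| <= r].
Proof.
rewrite (_ : mkset _ = (fun y => `|y - x|) @^-1` [set s | s <= r]) //.
apply: closed_comp; last exact: closed_le.
by move=> y _; apply: cvg_norm; apply: cvgB; [exact: cvg_id|exact: cvg_cst].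
Qed.

Lemma continuous_compose (T U W : topologicalType) (f : T -> U) (g : U -> W) :
  continuous f -> continuous g -> continuous (fun t => g (f t)).
Proof. by move=> fc gc t; apply: continuous_comp; [exact: fc|exact: gc]. Qed.

Lemma continuous_within_compose (T U W : topologicalType) (A : set U)
    (f : T -> U) (g : U -> W) :
  continuous f -> (forall t, A (f t)) -> {within A, continuous g} ->
  continuous (fun t => g (f t)).
Proof.
move=> fc fA /subspace_continuousP gA t.
apply: (@cvg_comp _ _ _ f g _ (within A (nbhs (f t)))); last exact: gA.
move=> B AB; change (nbhs t (fun u => B (f u))).
have : nbhs t (fun u => A (f u) -> B (f u)) by exact: fc t _ AB.
by apply: filterS => u; apply; exact: fA.
Qed.

Lemma exists_divn_lt (R : realType) (e d : R) : 0 < e -> 0 < d ->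
  exists n, e / n.+1%:R < d.
Proof.
move=> e0 d0; have de0 : 0 < d / e by rewrite divr_gt0.
near \oo => n; exists n; rewrite mulrC -ltr_pdivlMr//.
by near: n; exact: (near_infty_natSinv_lt (PosNum de0)).
Unshelve. all: by end_near. Qed.

(** The sets where Q holds and where it fails are both open in A. Local
    constancy is the form in which connectedness is used throughout: for the
    points where two lifts agree, for the points that a path can reach, and
    for the parameter of a homotopy. *)
Lemma connected_locally_constant (T : topologicalType) (A : set T)
    (Q : T -> Prop) (a : T) :
    connected A -> A a -> Q a ->
    (forall x, A x -> \forall y \near x, A y -> (Q y <-> Q x)) ->
  forall x, A x -> Q x.
Proof.
move=> Aconn Aa Qa Qloc.
suff -> : A = A `&` Q by move=> x [].
apply/esym/Aconn.
- by exists a.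
- exists [set y | A y -> Q y]° ; first exact: open_interior.
  apply/seteqP; split => x [Ax]; last first.
    by move=> /nbhs_singleton /(_ Ax).
  move=> Qx; split => //; apply: filterS (Qloc x Ax) => y Qyx Ay.
  exact/Qyx.
- exists (~` [set y | A y -> ~ Q y]°); first exact/open_closedC/open_interior.
  apply/seteqP; split => x [Ax].
    by move=> Qx; split => // /nbhs_singleton /(_ Ax).
  move=> nQ; split => //; apply: contrapT => nQx; apply: nQ.
  by apply: filterS (Qloc x Ax) => y Qyx Ay /(Qyx Ay).
Qed.

Lemma locally_constant (R : realType) (Q : R -> Prop) (a : R) :
  Q a -> (forall x, \forall y \near x, Q y <-> Q x) -> forall x, Q x.
Proof.
move=> Qa Qloc x; apply: (@connected_locally_constant _ setT Q a) => //.
  exact/connected_intervalP.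
by move=> y _; apply: filterS (Qloc y).
Qed.

Section Enumeration.
Variables (T : pointedType) (r : nat) (A : set T).
Hypothesis Ar : (A #= `I_r)%card.

Lemma card_enum : exists e : 'I_r -> T, injective e /\ range e = A.
Proof.
have /card_set_bijP[e [eA einj esurj]] : ([set: 'I_r] #= A)%card.
  by rewrite -(card_eql card_II) card_eq_sym.
exists e; split; first by move=> i j; apply: einj; rewrite inE.
by apply/seteqP; split => [_ [i _ <-]|]; [exact: eA|exact: esurj].
Qed.

Lemma card_inj_range (e : 'I_r -> T) :
  injective e -> (forall i, A (e i)) -> range e = A.
Proof.
move=> einj eA; have [f [finj fA]] := card_enum.
have /choice[k kE] : forall i, exists j, f j = e i.
  by move=> i; have := eA i; rewrite -fA => -[j _ <-]; exists j.
have kinj : injective k by move=> i j kij; apply: einj; rewrite -!kE kij.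
have [k' _ kK] := injF_bij kinj.
apply/seteqP; split => [_ [i _ <-]//|y].
by rewrite -fA => -[i _ <-]; exists (k' i) => //; rewrite -kE kK.
Qed.

End Enumeration.

(** * Paths parametrised by the whole line *)

(** The retraction of the line onto the unit interval. Precomposed with it,
    a path or homotopy given on the unit interval or square becomes a
    function that is continuous everywhere, so that no continuity within a
    subset has to be carried along. *)
Definition clamp (R : realType) (t : R) : R := Num.max 0 (Num.min t 1).

Section Clamp.
Variable R : realType.
Implicit Type t : R.

Lemma clamp_continuous : continuous (@clamp R).
Proof.
move=> t; apply: (@continuous_max R R (fun=> 0) (fun t => Num.min t 1)).
  exact: cvg_cst.
apply: (@continuous_min R R id (fun=> 1)); first exact: cvg_id.
exact: cvg_cst.
Qed.

Lemma clamp_itv t : clamp t \in `[0, 1].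
Proof. by rewrite in_itv /= le_max lexx /= ge_max ler01 ge_min lexx orbT. Qed.

Lemma clamp_id t : t \in `[0, 1] -> clamp t = t.
Proof. by rewrite in_itv /= /clamp => /andP[t0 t1]; rewrite min_l// max_r. Qed.

Lemma clamp_le0 t : t <= 0 -> clamp t = 0.
Proof. by move=> t0; rewrite /clamp max_l// ge_min t0. Qed.

Lemma clamp_ge1 t : 1 <= t -> clamp t = 1.
Proof. by move=> t1; rewrite /clamp min_r// max_r. Qed.

Lemma clamp0 : clamp (0 : R) = 0.
Proof. exact: clamp_le0. Qed.

Lemma clamp1 : clamp (1 : R) = 1.
Proof. exact: clamp_ge1. Qed.

Lemma clampK t : clamp (clamp t) = clamp t.
Proof. by rewrite clamp_id// clamp_itv. Qed.

End Clamp.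

Lemma clamp_compose (R : realType) (W : topologicalType) (z : R -> W) :
  {within `[0, 1]%classic, continuous z} -> continuous (fun t => z (clamp t)).
Proof.
move=> zc; apply: continuous_within_compose zc; first exact: clamp_continuous.
exact: clamp_itv.
Qed.

Lemma clamp_square_compose (R : realType) (W : topologicalType)
    (H : R * R -> W) :
  {within `[0, 1]%classic `*` `[0, 1]%classic, continuous H} ->
  continuous (fun st => H (clamp st.1, clamp st.2)).
Proof.
move=> Hc; apply: (continuous_within_compose _ _ Hc); last first.
  by move=> st; split; exact: clamp_itv.
have c1 : continuous (fun st : R * R => clamp st.1).
  by apply: continuous_compose (@clamp_continuous R) => st; exact: cvg_fst.
have c2 : continuous (fun st : R * R => clamp st.2).
  by apply: continuous_compose (@clamp_continuous R) => st; exact: cvg_snd.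
by move=> st; exact: (cvg_pair (c1 st) (c2 st)).
Qed.

Section Paths.
Variables (R : realType) (V : normedModType R) (U : set V).
Implicit Types (g h : R -> V) (p q s : V).

Definition path_from_to p q g : Prop :=
  [/\ continuous g, forall t, U (g t), forall t, t <= 0 -> g t = p &
      forall t, 1 <= t -> g t = q].

(** In a vector space the concatenation needs no case distinction: at each
    time one of the two paths rests at the common point q, which is
    subtracted. *)
Definition concat q g h (t : R) : V := g (2 * t) + h (2 * t - 1) - q.

Lemma concat_path p q s g h : path_from_to p q g -> path_from_to q s h ->
  [/\ path_from_to p s (concat q g h),
      forall t, t <= 1 -> concat q g h (t / 2) = g t &
      forall t, 0 <= t -> concat q g h ((t + 1) / 2) = h t].
Proof.
move=> [gc gU gp gq] [hc hU hq hs].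
have fst_half t : t <= 1 -> concat q g h (t / 2) = g t.
  move=> t1; rewrite /concat mulrC divfK ?pnatr_eq0// [h _]hq ?addrK//; lra.
have snd_half t : 0 <= t -> concat q g h ((t + 1) / 2) = h t.
  move=> t0; rewrite /concat mulrC divfK ?pnatr_eq0// [g _]gq; last by lra.
  by rewrite addrK addrC addKr.
split => //; split.
- have g2 : continuous (fun t : R => g (2 * t)).
    exact: (continuous_compose (@mulrl_continuous R 2) gc).
  have h2 : continuous (fun t : R => h (2 * t - 1)).
    apply: (@continuous_compose _ _ _ (fun t : R => 2 * t - 1) h _ hc) => t.
    by apply: cvgB; [exact: mulrl_continuous|exact: cvg_cst].
  by move=> t; apply: cvgB; [apply: cvgD; [exact: g2|exact: h2]|exact: cvg_cst].
- move=> t; have [t1|t1] := leP (2 * t) 1.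
    by rewrite (_ : t = 2 * t / 2) ?fst_half//; field.
  by rewrite (_ : t = (2 * t - 1 + 1) / 2) ?snd_half//; [lra|field].
- move=> t t0; have -> : t = 2 * t / 2 by field.
  by rewrite fst_half; [apply: gp|]; lra.
- move=> t t1; have -> : t = (2 * t - 1 + 1) / 2 by field.
  by rewrite snd_half; [apply: hs|]; lra.
Qed.

Lemma rev_path p q g :
  path_from_to p q g -> path_from_to q p (fun t => g (1 - t)).
Proof.
move=> [gc gU gp gq]; split => //.
- apply: (@continuous_compose _ _ _ (fun t : R => 1 - t) g _ gc) => t.
  by apply: cvgB; [exact: cvg_cst|exact: cvg_id].
- by move=> t t0; apply: gq; lra.
- by move=> t t1; apply: gp; lra.
Qed.

Lemma segment_path p q e : (forall v, `|v - p| < e -> U v) -> `|q - p| < e ->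
  path_from_to p q (fun t => p + clamp t *: (q - p)).
Proof.
move=> pU qp; split.
- move=> t; apply: cvgD; first exact: cvg_cst.
  by apply: cvgZr_tmp; exact: clamp_continuous.
- move=> t; apply: pU; rewrite addrC addKr normrZ.
  have := clamp_itv t; rewrite in_itv /= => /andP[t0 t1].
  by rewrite ger0_norm// (le_lt_trans _ qp)// ler_piMl.
- by move=> t t0; rewrite clamp_le0// scale0r addr0.
- by move=> t t1; rewrite clamp_ge1// scale1r addrC subrK.
Qed.

Lemma open_connected_path b : open U -> connected U -> U b ->
  forall p, U p -> exists g, path_from_to b p g.
Proof.
move=> Uo Uc Ub; apply: (connected_locally_constant Uc Ub).
  exists (fun=> b); split => // t; exact: cvg_cst.
move=> p Up.
have /nbhs_normP[e e0 eU] : nbhs p U by exact: open_nbhs_nbhs.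
have pU v : `|v - p| < e -> U v by move=> vp; apply: eU; rewrite /= distrC.
near=> q => Uq.
have qp : `|q - p| < e by near: q; exact: near_ball.
have pq := segment_path pU qp.
split=> -[g gP].
  by eexists; have [+ _ _] := concat_path gP (rev_path pq); exact.
by eexists; have [+ _ _] := concat_path gP pq; exact.
Unshelve. all: by end_near. Qed.

End Paths.

(** * Set-valued maps with separated values: lifting paths and homotopies *)

Section Covering.
Variables (R : realType) (X Y : normedModType R) (S : X -> set Y).

(** Injectivity of the projection of the graph of S to the parameters near a
    point of the graph, with an explicit radius. *)
Definition separates (p : X) (x : Y) (e : R) : Prop :=
  forall q y y', `|q - p| < e -> `|y - x| < e -> `|y' - x| < e ->
    S q y -> S q y' -> y = y'.

(** Lower semicontinuity of S at p relative to K. The restriction to K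
    matters: over the image of a loop this can hold although it fails on
    every neighbourhood. *)
Definition persistent_at (K : set X) (p : X) : Prop :=
  forall x, S p x -> forall e : R, 0 < e ->
    \forall q \near p, K q -> exists2 y, S q y & `|y - x| < e.

Definition is_lift (g : R -> X) (z : R -> Y) : Prop :=
  continuous z /\ forall t, S (g t) (z t).

Hypothesis S_separated :
  forall p x, S p x -> exists2 e, 0 < e & separates p x e.

Lemma lift_unique (g : R -> X) (z z' : R -> Y) t0 :
  continuous g -> is_lift g z -> is_lift g z' -> z t0 = z' t0 -> z = z'.
Proof.
move=> gc [zc zS] [z'c z'S] zz'; apply/funext.
apply: (@locally_constant _ (fun t => z t = z' t) t0) => // t.
have [zt|/eqP zt] := EM (z t = z' t).
  have [e e0 He] := S_separated (zS t).
  near=> u; split => // _; apply: (He (g u)) => //.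
  - by near: u; exact: near_dist (gc t) e0.
  - by near: u; exact: near_dist (zc t) e0.
  - by rewrite zt; near: u; exact: near_dist (z'c t) e0.
have d0 : 0 < `|z t - z' t| / 2 by rewrite divr_gt0// normr_gt0 subr_eq0.
near=> u; split => [zu|/eqP]; last by rewrite (negPf zt).
exfalso.
have h1 : `|z u - z t| < `|z t - z' t| / 2.
  by near: u; exact: near_dist (zc t) d0.
have h2 : `|z' u - z' t| < `|z t - z' t| / 2.
  by near: u; exact: near_dist (z'c t) d0.
have := ler_distD (z u) (z t) (z' t); rewrite [`|z t - z u|]distrC {2}zu.
lra.
Unshelve. all: by end_near. Qed.

(** At each time t with g t = p, one of the r lifts passes through x, and it
    stays near x for times near t. Compactness of the unit interval turns
    this into a statement about the parameters near p on the image of g: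
    such a parameter can only be reached at times near one at which g passes
    through p. *)
Lemma lifts_persistent (r : nat) (g : R -> X) (z : 'I_r -> R -> Y) t0 :
    continuous g -> (forall i, is_lift g (z i)) ->
    (forall t, (S (g t) #= `I_r)%card) -> injective (fun i => z i t0) ->
  forall p, persistent_at (g @` `[0, 1]) p.
Proof.
move=> gc zl gr zinj p x px e e0.
have /compact_near_coveringP seg := @segment_compact R 0 1.
have : \forall q \near p, `[0, 1] `<=`
    (fun t => g t = q -> exists2 y, S q y & `|y - x| < e).
  apply: (seg _ _ (fun q t => g t = q -> _)) => t _.
  have [gtp|/eqP gtp] := EM (g t = p).
    have [i _ zix] : range (z^~ t) x.
      rewrite (card_inj_range (gr t)) ?gtp// => [i j zij|i].
        by apply: zinj; rewrite (lift_unique gc (zl i) (zl j) zij).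
      by have [_] := zl i; rewrite -gtp; exact.
    near=> u q => /= guq; exists (z i u).
      by rewrite -guq; exact: (zl i).2.
    by rewrite -zix; near: u; exact: near_dist ((zl i).1 t) e0.
  have d0 : 0 < `|g t - p| / 2 by rewrite divr_gt0// normr_gt0 subr_eq0.
  near=> u q => /= guq; exfalso.
  have h1 : `|g u - g t| < `|g t - p| / 2.
    by near: u; exact: near_dist (gc t) d0.
  have h2 : `|q - p| < `|g t - p| / 2 by near: q; exact: near_ball.
  have := ler_distD (g u) (g t) p; rewrite [`|g t - g u|]distrC {2}guq.
  lra.
by apply: filterS => q Pq [t t01 gtq]; exact: Pq gtq.
Unshelve. all: by end_near. Qed.

Section Sheets.
Variables (r : nat) (K : set X).
Hypothesis Kr : forall p, K p -> (S p #= `I_r)%card.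
Hypothesis Kpers : forall p, K p -> persistent_at K p.

Lemma persistent_uniform p e : K p -> 0 < e ->
  \forall q \near p, K q -> forall x, S p x -> exists2 y, S q y & `|y - x| < e.
Proof.
move=> Kp e0; have [s [_ sE]] := card_enum (Kr Kp).
have : \forall q \near p, forall i, K q -> exists2 y, S q y & `|y - s i| < e.
  by apply: filter_forall => i; apply: Kpers => //; rewrite -sE; exists i.
by apply: filterS => q H Kq x; rewrite -sE => -[i _ <-]; exact: H.
Qed.

(** The r points of the fibre over p persist to r distinct points of the
    fibre over q, which has only r points. *)
Lemma sheets_exhaust p e : K p -> 0 < e ->
  \forall q \near p, K q -> forall y, S q y -> exists2 x, S p x & `|y - x| < e.
Proof.
move=> Kp e0; have [s [sinj sE]] := card_enum (Kr Kp).
(* With d below half the mutual distances, the points found near distinct s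
   i are distinct. *)
have [d [d0 de dsep]] : exists d, [/\ 0 < d, d <= e &
    forall i j, i != j -> d < `|s i - s j| / 2].
  near (0 : R)^'+ => d; exists d; split => //.
    by near: d; exact: nbhs_right_le.
  near: d; apply: filter_forall => i; apply: filter_forall => j.
  have [_|ij] := eqVneq i j; first exact: nearW.
  near=> d => _; near: d; apply: nbhs_right_lt.
  by rewrite divr_gt0// normr_gt0 subr_eq0 (inj_eq sinj).
have := persistent_uniform Kp d0; apply: filterS => q Hq Kq y Sy.
have /choice[w wE] : forall i, exists y, S q y /\ `|y - s i| < d.
  by move=> i; have [|v] := Hq Kq (s i); [rewrite -sE; exists i|exists v].
have winj : injective w.
  move=> i j wij; apply/eqP/negP => /negP /dsep.
  have := ler_distD (w i) (s i) (s j); rewrite [`|s i - w i|]distrC {2}wij.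
  move: (wE i).2 (wE j).2; lra.
have : range w y by rewrite (card_inj_range (Kr Kq) winj) // => i; case: (wE i).
move=> [i _ <-]; exists (s i); first by rewrite -sE; exists i.
exact: lt_le_trans (wE i).2 de.
Unshelve. all: by end_near. Qed.

(** A bound valid at each of the finitely many points over p is valid,
    halved, at all points over the parameters of K near p, because these lie
    near points over p. *)
Lemma uniform_separation : compact K ->
  exists2 rho, 0 < rho & forall p x, K p -> S p x -> separates p x rho.
Proof.
move=> /compact_near_coveringP/near_covering_withinP Kc.
have : \forall rho \near (0 : R)^'+, K `<=`
    (fun p => forall x, S p x -> separates p x rho).
  apply: (Kc _ _ (fun rho p => forall x, S p x -> separates p x rho)) => p Kp.
  have [s [_ sE]] := card_enum (Kr Kp).
  have [e [e0 esep]] : exists e, 0 < e /\ forall i, separates p (s i) e.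
    near (0 : R)^'+ => e; exists e; split => //.
    near: e; apply: filter_forall => i.
    have [d d0 dsep] : exists2 e, 0 < e & separates p (s i) e.
      by apply: S_separated; rewrite -sE; exists i.
    near=> e => q y y' qe ye y'e.
    have ed : e < d by near: e; exact: nbhs_right_lt.
    by apply: dsep; apply: lt_trans ed.
  have e20 : 0 < e / 2 by rewrite divr_gt0.
  near=> q rho => /= Kq y Sy q' y1 y2 q'q y1y y2y.
  have [x Spx yx] : exists2 x, S p x & `|y - x| < e / 2.
    by move: Kq y Sy {y1y y2y}; near: q; exact: sheets_exhaust.
  move: (Spx); rewrite -sE => -[i _ six]; subst x.
  have qp : `|q - p| < e / 2 by near: q; exact: near_ball.
  have rhoe : rho < e / 2 by near: rho; exact: nbhs_right_lt.
  apply: (esep i q').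
  - by have := ler_distD q q' p; lra.
  - by have := ler_distD y y1 (s i); lra.
  - by have := ler_distD y y2 (s i); lra.
move=> H; near (0 : R)^'+ => rho; exists rho => // p x Kp.
by move: p Kp x; near: rho.
Unshelve. all: by end_near. Qed.

Lemma uniform_persistence rho : compact K -> 0 < rho ->
  exists2 delta, 0 < delta & forall p q x, K p -> K q -> S p x ->
    `|q - p| < delta -> exists2 y, S q y & `|y - x| < rho.
Proof.
move=> /compact_near_coveringP/near_covering_withinP Kc rho0.
pose P delta p := forall q x, K q -> S p x -> `|q - p| < delta ->
  exists2 y, S q y & `|y - x| < rho.
have : \forall delta \near (0 : R)^'+, K `<=` P delta.
  apply: (Kc _ _ P) => p Kp.
  have rho20 : 0 < rho / 2 by rewrite divr_gt0.
  have [d /= d0 dP] := (nbhs_normP _ _).1 (persistent_uniform Kp rho20).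
  have d20 : 0 < d / 2 by rewrite divr_gt0.
  near=> p' delta => /= Kp' q x Kq Sx qp'.
  have [x0 Sx0 xx0] : exists2 x0, S p x0 & `|x - x0| < rho / 2.
    by move: Kp' x Sx; near: p'; exact: sheets_exhaust.
  have p'p : `|p' - p| < d / 2 by near: p'; exact: near_ball.
  have deltad : delta < d / 2 by near: delta; exact: nbhs_right_lt.
  have [|y Sy yx0] := dP q _ Kq x0 Sx0.
    by rewrite /= distrC; have := ler_distD p' q p; lra.
  exists y => //; have := ler_distD x0 y x; rewrite [`|x0 - x|]distrC; lra.
move=> H; near (0 : R)^'+ => delta; exists delta => // p q x Kp.
by move: q x; move: p Kp; near: delta.
Unshelve. all: by end_near. Qed.

(** The lift of g' is the point of the fibre over g' t next to z t;
    separation makes it unique, and persistence at g' t makes it continuous,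
    since the point that continues z' t is still close enough to z u to be
    z' u. *)
Lemma lift_nearby (rho : R) (g g' : R -> X) (z : R -> Y) :
    (forall p x, K p -> S p x -> separates p x rho) ->
    (forall t, K (g t)) -> (forall t, K (g' t)) -> continuous g' ->
    (forall t, `|g' t - g t| < rho) -> is_lift g z ->
    (forall t, exists2 y, S (g' t) y & `|y - z t| < rho / 2) ->
  exists2 z', is_lift g' z' & forall t, `|z' t - z t| < rho.
Proof.
move=> sep Kg Kg' g'c gg' [zc zS].
have rho0 : 0 < rho by apply: le_lt_trans (gg' 0).
have rho40 : 0 < rho / 4 by rewrite divr_gt0.
move=> H; have /choice[z' z'E] : forall t, exists y,
    S (g' t) y /\ `|y - z t| < rho / 2.
  by move=> t; have [y] := H t; exists y.
exists z'; last by move=> t; have := (z'E t).2; lra.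
split; last by move=> t; case: (z'E t).
move=> t; apply/cvgrPdist_lt => e e0.
have m0 : 0 < Num.min e (rho / 4) by rewrite lt_min e0.
near=> u.
have [y Sy] : exists2 y, S (g' u) y & `|y - z' t| < Num.min e (rho / 4).
  have : K (g' u) by [].
  near: u; apply: (g'c t (fun q => K q -> exists2 y, S q y & _)).
  by apply: Kpers => //; case: (z'E t).
rewrite lt_min => /andP[ye yrho].
have zut : `|z u - z t| < rho / 4 by near: u; exact: near_dist (zc t) rho40.
suff -> : z' u = y by rewrite distrC.
apply: (sep _ _ (Kg u) (zS u) (g' u)) => //; last by case: (z'E u).
  by have := (z'E u).2; lra.
have := ler_distD (z' t) y (z u); have := ler_distD (z t) (z' t) (z u).
rewrite [`|z t - z u|]distrC; have := (z'E t).2; lra.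
Unshelve. all: by end_near. Qed.

End Sheets.

(** Copying lifts between neighbouring stages of the homotopy preserves both
    endpoints, by separation over the fixed point b. The constant last stage
    lifts only to constant paths. *)
Lemma lift_homotopy (r : nat) (K : set X) (H : R * R -> X) (b : X)
    (z : R -> Y) :
    compact K -> (forall p, K p -> (S p #= `I_r)%card) ->
    (forall p, K p -> persistent_at K p) ->
    continuous H -> (forall st, K (H st)) ->
    (forall s t, H (s, clamp t) = H (s, t)) ->
    (forall t, H (1, t) = b) ->
    (forall s, H (s, 0) = b) -> (forall s, H (s, 1) = b) ->
    is_lift (fun t => H (0, t)) z ->
  z 0 = z 1.
Proof.
move=> Kc Kr Kpers Hc KH Hclamp H1 Hs0 Hs1 zl.
have [rho rho0 sep] := uniform_separation Kr Kpers Kc.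
have rho20 : 0 < rho / 2 by rewrite divr_gt0.
have [d d0 pers] := uniform_persistence Kr Kpers Kc rho20.
have m0 : 0 < Num.min d rho by rewrite lt_min d0.
pose Q s := exists z',
  [/\ is_lift (fun t => H (s, t)) z', z' 0 = z 0 & z' 1 = z 1].
(* The hypothesis of closeness is symmetric in s and s', which makes Q
   locally constant and not merely open. *)
have Qstep s s' : (forall t, `|H (s', t) - H (s, t)| < Num.min d rho) ->
    Q s -> Q s'.
  move=> ss' [w [wl w0 w1]].
  have [|||w' w'l w'w] := @lift_nearby K Kpers rho (fun t => H (s, t))
    (fun t => H (s', t)) w sep (fun=> KH _) (fun=> KH _) _ _ wl _.
  - apply: (continuous_compose _ Hc) => t.
    apply: (@cvg_pair _ _ _ (nbhs t) (nbhs s') (nbhs t)); last exact: cvg_id.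
    exact: cvg_cst.
  - by move=> t; have := ss' t; rewrite lt_min => /andP[].
  - move=> t; apply: (pers (H (s, t))) => //; first exact: wl.2.
    by have := ss' t; rewrite lt_min => /andP[].
  have w'S t : S (H (s', t)) (w' t) by exact: w'l.2.
  have wS t : S (H (s, t)) (w t) by exact: wl.2.
  exists w'; split => //.
    rewrite -w0; apply: (sep _ _ (KH (s, 0)) (wS 0) (H (s', 0))).
    - by have := ss' 0; rewrite lt_min => /andP[].
    - exact: w'w.
    - by rewrite subrr normr0.
    - exact: w'S.
    - by rewrite Hs0 -(Hs0 s).
  rewrite -w1; apply: (sep _ _ (KH (s, 1)) (wS 1) (H (s', 1))).
  - by have := ss' 1; rewrite lt_min => /andP[].
  - exact: w'w.
  - by rewrite subrr normr0.
  - exact: w'S.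
  - by rewrite Hs1 -(Hs1 s).
have [z1 [z1l z10 z11]] : Q 1.
  apply: (@locally_constant _ Q 0); first by exists z.
  move=> s.
  have /compact_near_coveringP seg := @segment_compact R 0 1.
  have : \forall s' \near s, `[0, 1] `<=`
      (fun t => `|H (s', t) - H (s, t)| < Num.min d rho).
    have m20 : 0 < Num.min d rho / 2 by rewrite divr_gt0.
    pose close s' t := `|H (s', t) - H (s, t)| < Num.min d rho.
    apply: (seg _ (nbhs s) close) => t _.
    have [[A B] /= [As Bt] AB] := near_dist (Hc (s, t)) m20.
    near=> t' s' => /=; rewrite /close.
    have h1 : `|H (s', t') - H (s, t)| < Num.min d rho / 2.
      by apply: (AB (s', t')); split => /=; [near: s'|near: t'].
    have h2 : `|H (s, t') - H (s, t)| < Num.min d rho / 2.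
      by apply: (AB (s, t')); split => /=; [exact: nbhs_singleton|near: t'].
    have := ler_distD (H (s, t)) (H (s', t')) (H (s, t')).
    rewrite [`|H (s, t) - H (s, t')|]distrC; lra.
  apply: filterS => s' Hs'.
  have Hs't t : `|H (s', t) - H (s, t)| < Num.min d rho.
    by rewrite -Hclamp -(Hclamp s); apply: Hs'; exact: clamp_itv.
  split; apply: Qstep => // t.
  by rewrite distrC.
have cstl : is_lift (fun t => H (1, t)) (fun=> z1 0).
  split=> [t|t]; first exact: cvg_cst.
  by rewrite H1 -(H1 0); exact: z1l.2.
rewrite -z10 -z11.
have Hc1 : continuous (fun t => H (1, t)).
  by rewrite (funext H1) => t; exact: cvg_cst.
by rewrite (lift_unique Hc1 z1l cstl (erefl (z1 0))).
Unshelve. all: by end_near. Qed.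

End Covering.

Lemma persistent_subset (R : realType) (X Y : normedModType R) (S : X -> set Y)
    (K U : set X) p :
  K `<=` U -> persistent_at S U p -> persistent_at S K p.
Proof.
move=> KU Uper x Sx e e0; apply: filterS (Uper x Sx e e0) => q H Kq.
exact/H/KU.
Qed.

(** * Strict differentiability of polynomials *)

Section SupNorm.
Variable R : realType.

Lemma mx_entry_le m n (A : 'M[R]_(m, n)) i j : `|A i j| <= `|A|.
Proof.
rewrite [leRHS]/Num.norm /= mx_normrE.
by apply: (le_bigmax _ (fun ij => `|A ij.1 ij.2|) (i, j)).
Qed.

Lemma mx_norm_le m n (A : 'M[R]_(m, n)) c :
  0 <= c -> (forall i j, `|A i j| <= c) -> `|A| <= c.
Proof.
move=> c0 Ac; rewrite [leLHS]/Num.norm /= mx_normrE.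
by apply: bigmax_le => // -[i j] _; exact: Ac.
Qed.

Lemma mulmx_bounded m n (B : 'M[R]_(m, n)) :
  exists2 C, 0 <= C & forall u : 'rV[R]_m, `|u *m B| <= C * `|u|.
Proof.
exists (\sum_i \sum_j `|B i j|).
  by apply: sumr_ge0 => i _; exact: sumr_ge0.
move=> u; apply: mx_norm_le => [|i j].
  by rewrite mulr_ge0//; apply: sumr_ge0 => i _; exact: sumr_ge0.
rewrite mxE (le_trans (ler_norm_sum _ _ _))// mulr_suml ler_sum// => k _.
rewrite normrM mulrC ler_pM//; last exact: mx_entry_le.
by rewrite (bigD1 j)//= lerDl sumr_ge0.
Qed.

Lemma row_mx_norm_le n1 n2 (u : 'rV[R]_n1) (v : 'rV[R]_n2) c :
  `|u| <= c -> `|v| <= c -> `|row_mx u v| <= c.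
Proof.
move=> uc vc; apply: mx_norm_le => [|i j]; first exact: le_trans uc.
rewrite mxE; case: splitP => k _.
  exact: le_trans (mx_entry_le _ _ _) uc.
exact: le_trans (mx_entry_le _ _ _) vc.
Qed.

End SupNorm.

Section StrictDifferentiability.
Variables (R : realType) (V : normedModType R).
Implicit Types (f g L : V -> R) (v h : V).

(** Differentiability uniform over pairs of points tending to v. It provides
    the Lipschitz estimate needed for the inverse function theorem at once,
    and passes to sums and products pointwise, so that polynomials are
    reached by induction without a mean value theorem. *)
Definition strict_diff_at v f L : Prop :=
  (exists2 C, 0 <= C & forall h, `|L h| <= C * `|h|) /\
  forall e, 0 < e -> \forall w \near (v, v),
    `|f w.1 - f w.2 - L (w.1 - w.2)| <= e * `|w.1 - w.2|.

Lemma strict_diff_cvg v f L : strict_diff_at v f L -> {for v, continuous f}.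
Proof.
move=> [[C C0 LC] fL]; apply/cvgrPdist_lt => e e0.
have := fL 1 ltr01; move=> [[A B] [Av Bv] AB].
have d0 : 0 < e / (C + 1) by rewrite divr_gt0// ltr_wpDl.
near=> u.
have u1 : `|f v - f u - L (v - u)| <= 1 * `|v - u|.
  by apply: (AB (v, u)); split => /=; [exact: nbhs_singleton Av|near: u].
have u2 : `|u - v| < e / (C + 1) by near: u; exact: near_ball.
have := ler_normD (f v - f u - L (v - u)) (L (v - u)); rewrite subrK.
move=> /le_lt_trans; apply; apply: le_lt_trans (lerD u1 (LC _)) _.
by rewrite -mulrDl distrC addrC mulrC -ltr_pdivlMr// ltr_wpDl.
Unshelve. all: by end_near. Qed.

Lemma strict_diff_cst v c : strict_diff_at v (fun=> c) (fun=> 0).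
Proof.
split; first by exists 0 => // h; rewrite normr0 mul0r.
by move=> e e0; near=> w; rewrite !subrr normr0 mulr_ge0// ltW.
Unshelve. all: by end_near. Qed.

Lemma strict_diffD v f g Lf Lg :
  strict_diff_at v f Lf -> strict_diff_at v g Lg ->
  strict_diff_at v (fun u => f u + g u) (fun h => Lf h + Lg h).
Proof.
move=> [[C C0 LfC] fL] [[D D0 LgD] gL]; split.
  exists (C + D) => [|h]; first exact: addr_ge0.
  by rewrite mulrDl (le_trans (ler_normD _ _))// lerD.
move=> e e0; have e20 : 0 < e / 2 by rewrite divr_gt0.
near=> w.
have fw : `|f w.1 - f w.2 - Lf (w.1 - w.2)| <= e / 2 * `|w.1 - w.2|.
  by near: w; exact: fL.
have gw : `|g w.1 - g w.2 - Lg (w.1 - w.2)| <= e / 2 * `|w.1 - w.2|.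
  by near: w; exact: gL.
rewrite [leRHS](_ : _ = e / 2 * `|w.1 - w.2| + e / 2 * `|w.1 - w.2|);
  last by field.
apply: le_trans (lerD fw gw); apply: le_trans (ler_normD _ _).
by rewrite le_eqVlt; apply/orP; left; apply/eqP; congr `|_|; ring.
Unshelve. all: by end_near. Qed.

Lemma strict_diffM v f g Lf Lg :
  strict_diff_at v f Lf -> strict_diff_at v g Lg ->
  strict_diff_at v (fun u => f u * g u) (fun h => Lf h * g v + f v * Lg h).
Proof.
move=> fLf gLg; have [fc gc] := (strict_diff_cvg fLf, strict_diff_cvg gLg).
move: fLf gLg => [[C C0 LfC] fL] [[D D0 LgD] gL]; split.
  exists (C * `|g v| + `|f v| * D) => [|h].
    by rewrite addr_ge0// mulr_ge0.
  rewrite mulrDl (le_trans (ler_normD _ _))// !normrM lerD//.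
    by rewrite -mulrA [`|g v| * _]mulrC mulrA ler_wpM2r.
  by rewrite -mulrA ler_wpM2l.
move=> e e0.
set m := 2 + C + D + `|f v| + `|g v|.
have m0 : 0 < m by rewrite /m !ltr_pwDl// ltr0n.
pose d := Num.min 1 (e / m).
have d0 : 0 < d by rewrite lt_min ltr01 divr_gt0.
have d1 : d <= 1 by rewrite ge_min lexx.
have dm : d * m <= e by rewrite -ler_pdivlMr// ge_min lexx orbT.
near=> w.
have fw : `|f w.1 - f w.2 - Lf (w.1 - w.2)| <= d * `|w.1 - w.2|.
  by near: w; exact: fL.
have gw : `|g w.1 - g w.2 - Lg (w.1 - w.2)| <= d * `|w.1 - w.2|.
  by near: w; exact: gL.
have f1 : `|f w.1 - f v| <= d.
  apply/ltW; near: w; apply: (@near_dist _ _ _ (f \o fst)) => //.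
  by apply: continuous_comp => //; exact: cvg_fst.
have g2 : `|g w.2 - g v| <= d.
  apply/ltW; near: w; apply: (@near_dist _ _ _ (g \o snd)) => //.
  by apply: continuous_comp => //; exact: cvg_snd.
move: f1 g2 fw gw (LfC (w.1 - w.2)) (LgD (w.1 - w.2)).
set h := `|w.1 - w.2|; set a := _ - Lf _; set b := _ - Lg _.
set lf := Lf _; set lg := Lg _; set s := f w.1 - f v; set t := g w.2 - g v.
move=> sd td ad bd lfC lgD.
have h0 : 0 <= h by exact: normr_ge0.
(* Here s and t are the increments of f and g from v, and a and b the errors
   of their linear approximations; each of the four terms is therefore small
   compared with the displacement. *)
rewrite [X in `|X|](_ : _ = s * (b + lg) + f v * b + t * (a + lf) + g v * a);
  last by rewrite /s /t /a /b /lf /lg; ring.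
apply: (@le_trans _ _ (d * m * h)); last by rewrite ler_wpM2r.
rewrite [leRHS](_ : _ = d * ((1 + D) * h) + `|f v| * (d * h) +
    d * ((1 + C) * h) + `|g v| * (d * h)); last by rewrite /m; ring.
have bound x c l : `|x| <= d * h -> `|l| <= c * h -> `|x + l| <= (1 + c) * h.
  move=> xd lc; rewrite (le_trans (ler_normD _ _))// mulrDl lerD// mul1r.
  by rewrite (le_trans xd)// ler_piMl.
have boundM x y c1 c2 : `|x| <= c1 -> `|y| <= c2 -> `|x * y| <= c1 * c2.
  by move=> xc yc; rewrite normrM ler_pM.
by do 3?[apply: le_trans (ler_normD _ _) (lerD _ _)];
  apply: boundM => //; apply: bound.
Unshelve. all: by end_near. Qed.

End StrictDifferentiability.

Section StrictDifferentiabilityPoly.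
Variables (R : realType) (n : nat).
Implicit Types (v h : 'rV[R]_n).

Lemma strict_diff_coord v i :
  strict_diff_at v (fun u : 'rV[R]_n => u 0 i) (fun h => h 0 i).
Proof.
split; first by exists 1 => // h; rewrite mul1r mx_entry_le.
by move=> e e0; near=> w; rewrite !mxE subrr normr0 mulr_ge0// ltW.
Unshelve. all: by end_near. Qed.

Lemma meval_strict_diff (p : mpoly n R) v :
  strict_diff_at v (fun u : 'rV[R]_n => meval (u 0) p)
    (fun h => \sum_i meval (v 0) (mderiv i p) * h 0 i).
Proof.
pose good p := strict_diff_at v (fun u : 'rV[R]_n => meval (u 0) p)
    (fun h => \sum_i meval (v 0) (mderiv i p) * h 0 i).
have ext f f' L L' : strict_diff_at v f L -> f =1 f' -> L =1 L' ->
    strict_diff_at v f' L'.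
  by move=> fL /funext <- /funext <-.
have goodC c : good (mpolyC n c).
  apply: (ext _ _ _ _ (strict_diff_cst v c)) => [u|h]; first by rewrite mevalC.
  by rewrite big1// => i _; rewrite mderivC meval0 mul0r.
have goodX i : good (mpolyX R (mnm1 i)).
  apply: (ext _ _ _ _ (strict_diff_coord v i)) => [u|h].
    by rewrite mevalXU.
  rewrite (bigD1 i)//= big1 => [|j ji].
    rewrite mderivX mnm1E eqxx scale1r addr0.
    by rewrite -[X in mnm_sub X _]add0m addmK mpolyX0 meval1 mul1r.
  by rewrite mderivX mnm1E eq_sym (negPf ji) scale0r meval0 mul0r.
have goodM q q' : good q -> good q' -> good (q * q').
  move=> gq gq'; apply: (ext _ _ _ _ (strict_diffM gq gq')) => [u|h].
    by rewrite mevalM.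
  rewrite mulr_suml mulr_sumr -big_split/=; apply: eq_bigr => i _.
  by rewrite mderivM mevalD !mevalM; ring.
have goodD q q' : good q -> good q' -> good (q + q').
  move=> gq gq'; apply: (ext _ _ _ _ (strict_diffD gq gq')) => [u|h].
    by rewrite mevalD.
  rewrite -big_split/=; apply: eq_bigr => i _.
  by rewrite mderivD mevalD mulrDl.
change (good p).
elim/mpolyind: p => [|c m p _ _ gp]; first by rewrite -mpolyC0.
apply: goodD => //; rewrite -mul_mpolyC; apply: (goodM _ _) => //.
rewrite mpolyXE_id; elim/big_ind: _ => [|q q'|i _]; last first.
- elim: (m i) => [|k IH]; first by rewrite expr0 -mpolyC1.
  by rewrite exprS; exact: goodM.
- exact: goodM.
- by rewrite -mpolyC1.
Qed.

End StrictDifferentiabilityPoly.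

(** * Local uniqueness and local existence of nonsingular solutions *)

Section ImplicitFunction.
Variables (R : realType) (M N P : nat) (F : poly_system R M N P).

Definition values (p : 'rV[R]_P) (x : 'rV[R]_N) : 'rV[R]_M :=
  \row_i peval (F i) x p.

Lemma solution_values p x : is_solution F p x <-> values p x = 0.
Proof.
split=> [Fx|/rowP Fx i]; last by have := Fx i; rewrite !mxE.
by apply/rowP => i; rewrite !mxE Fx.
Qed.

Lemma peval_near (f : mpoly (N + P) R) p x e : 0 < e ->
  exists2 d, 0 < d & forall q y, `|q - p| < d -> `|y - x| < d ->
    `|peval f y q - peval f x p| < e.
Proof.
move=> e0.
have := near_dist (strict_diff_cvg (meval_strict_diff f (row_mx x p))) e0.
move=> /nbhs_normP[d /= d0 dP]; exists (d / 2); first by rewrite divr_gt0.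
move=> q y qp yx; apply: dP => /=.
rewrite opp_row_mx add_row_mx.
have : `|row_mx (x - y) (p - q)| <= d / 2.
  by apply: row_mx_norm_le; rewrite distrC ltW.
lra.
Qed.

Lemma values_strict p x e : 0 < e ->
  exists2 d, 0 < d & forall q y y', `|q - p| < d -> `|y - x| < d ->
    `|y' - x| < d ->
    `|values q y - values q y' - (y - y') *m (jacobian_x F p x)^T| <=
      e * `|y - y'|.
Proof.
move=> e0; set v := row_mx x p.
pose good (w : 'rV[R]_(N + P) * 'rV[R]_(N + P)) := forall i : 'I_M,
    `|meval (w.1 0) (F i) - meval (w.2 0) (F i) -
      \sum_j meval (v 0) (mderiv j (F i)) * (w.1 - w.2) 0 j|
      <= e * `|w.1 - w.2|.
have : \forall w \near (v, v), good w.
  exact: filter_forall (fun i => (meval_strict_diff (F i) v).2 e e0).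
move=> [[A B] [/nbhs_normP[a a0 aA] /nbhs_normP[b b0 bB]] AB].
have m0 : 0 < Num.min a b / 2 by rewrite divr_gt0// lt_min a0.
exists (Num.min a b / 2) => // q y y' qp yx y'x.
have dist z : `|z - x| < Num.min a b / 2 -> `|v - row_mx z q| < Num.min a b.
  move=> zx; rewrite opp_row_mx add_row_mx.
  have : `|row_mx (x - z) (p - q)| <= Num.min a b / 2.
    by apply: row_mx_norm_le; rewrite distrC ltW.
  lra.
have {}AB i := AB (row_mx y q, row_mx y' q) _ i.
apply: mx_norm_le => [|i0 i]; first by rewrite mulr_ge0// ltW.
rewrite ord1 {i0}; apply: le_trans (le_trans (AB _ i) _).
- have subE (s t : 'rV[R]_M) : (s - t) 0 i = s 0 i - t 0 i by rewrite !mxE.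
  have valE z : values q z 0 i = peval (F i) z q by rewrite mxE.
  rewrite 2!subE !valE; suff <- : \sum_j meval (v 0) (mderiv j (F i)) *
      (row_mx y q - row_mx y' q) 0 j = ((y - y') *m (jacobian_x F p x)^T) 0 i.
    by [].
  rewrite opp_row_mx add_row_mx subrr big_split_ord /=.
  rewrite [X in _ + X]big1 ?addr0 => [|j _]; last by rewrite row_mxEr mxE mulr0.
  by rewrite mxE; apply: eq_bigr => j _; rewrite row_mxEl mulrC !mxE.
- split; [apply: aA|apply: bB] => /=.
    by have := dist _ yx; rewrite lt_min => /andP[].
  by have := dist _ y'x; rewrite lt_min => /andP[].
- rewrite ler_pM2l//= opp_row_mx add_row_mx subrr; apply: row_mx_norm_le => //.
  by rewrite normr0.
Qed.

(** B is the transpose of a left inverse of the Jacobian matrix, so that the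
    preconditioned system has the identity as strict derivative in x. If M
    <= N, the rank makes the Jacobian matrix square and B invertible, and
    the zeros of the preconditioned system are solutions of the system
    itself; if M > N they need not be. *)
Lemma values_preconditioned p x : \rank (jacobian_x F p x) = N ->
  exists2 B : 'M[R]_(M, N),
    ((M <= N)%N -> forall u : 'rV_M, u *m B = 0 -> u = 0) &
  exists2 d, 0 < d & forall q y y', `|q - p| < d -> `|y - x| < d ->
    `|y' - x| < d ->
    `|values q y *m B - values q y' *m B - (y - y')| <= `|y - y'| / 2.
Proof.
set J := jacobian_x F p x => rJ.
have /row_fullP[C CJ] : row_full J by rewrite /row_full rJ.
exists C^T.
  move=> MN u /eqP; rewrite mulmx_free_eq0 => [/eqP//|].
  have /eqP rC : row_free C by apply/row_freeP; exists J.
  by rewrite /row_free mxrank_tr rC eqn_leq MN -rJ rank_leq_row.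
have [D D0 CD] := mulmx_bounded C^T.
have D1 : 0 < D + 1 by rewrite ltr_wpDl.
have e0 : 0 < (D + 1)^-1 / 2 by rewrite divr_gt0// invr_gt0.
have [d d0 dP] := values_strict p x e0.
exists d => // q y y' qp yx y'x.
rewrite -mulmxBl [X in _ *m _ - X](_ : _ = (y - y') *m J^T *m C^T); last first.
  by rewrite -mulmxA -trmx_mul CJ trmx1 mulmx1.
rewrite -mulmxBl.
apply: le_trans (CD _) _; apply: le_trans (ler_wpM2l D0 (dP _ _ _ qp yx y'x)) _.
rewrite mulrA mulrC ler_wpM2l// -[leRHS]mul1r mulrA ler_pM2r ?invr_gt0//.
by rewrite ler_pdivrMr// mul1r lerDl.
Qed.

(** The difference of two solutions is at most half of itself in norm. *)
Lemma nonsingular_separates p x : \rank (jacobian_x F p x) = N ->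
  exists2 e, 0 < e & separates (is_solution F) p x e.
Proof.
move=> /values_preconditioned[B _ [d d0 dP]]; exists d => // q y y' qp yx y'x.
move=> /solution_values Sy /solution_values Sy'.
have := dP q y y' qp yx y'x; rewrite Sy Sy' mul0mx subrr sub0r normrN.
move=> h; apply/eqP; rewrite -subr_eq0 -normr_le0; lra.
Qed.

Lemma nonsingular_isolated p x :
  nonsingular_solution F p x -> isolated_solution F p x.
Proof.
move=> [Fx /nonsingular_separates[e e0 sep]]; split => //.
near=> y => Fy.
have yx : `|y - x| < e by near: y; exact: (@near_ball R 'rV[R]_N).
by apply: (sep p); rewrite ?subrr ?normr0.
Unshelve. all: by end_near. Qed.

Lemma nonsing_isolated_separates p x : nonsing_isolated F p x ->
  exists2 e, 0 < e & separates (nonsing_isolated F) p x e.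
Proof.
move=> [[_ /nonsingular_separates[e e0 sep]] _]; exists e => //.
by move=> q y y' qp yx y'x [[Fy _] _] [[Fy' _] _]; exact: (sep q).
Qed.

End ImplicitFunction.

Section ImplicitFunctionSquare.
Variables (R : realType) (N P : nat) (F : poly_system R N N P).

(** The Jacobian determinant is itself a polynomial in x and p, hence
    continuous. *)
Lemma jacobian_unit_near p x : \rank (jacobian_x F p x) = N ->
  exists2 d, 0 < d & forall q y, `|q - p| < d -> `|y - x| < d ->
    \rank (jacobian_x F q y) = N.
Proof.
move=> /eqP rJ.
pose D := \det (\matrix_(i < N, j < N) mderiv (lshift P j) (F i)).
have DE q y : peval D y q = \det (jacobian_x F q y).
  rewrite /peval /D -det_map_mx; congr (\det _).
  by apply/matrixP => i j; rewrite !mxE.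
have D0 : 0 < `|peval D x p|.
  by rewrite normr_gt0 DE -unitfE -unitmxE -row_free_unit.
have [d d0 dP] := peval_near D p x D0.
exists d => // q y qp yx; apply/eqP.
rewrite -[_ == _]/(row_free _) row_free_unit unitmxE unitfE -DE -normr_gt0.
have := dP q y qp yx; have := ler_distD (peval D y q) (peval D x p) 0.
rewrite !subr0 [`|peval D x p - _|]distrC; lra.
Qed.

(** A point y of the ball at which the norm of G is minimal is a zero: it
    lies well inside the ball, and the step from y to y - G y would at least
    halve the norm. *)
Lemma near_identity_zero (G : 'rV[R]_N -> 'rV[R]_N) x rho : 0 < rho ->
    (forall y y', `|y - x| <= rho -> `|y' - x| <= rho ->
      `|G y - G y' - (y - y')| <= `|y - y'| / 2) ->
    `|G x| < rho / 8 ->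
  exists2 y, `|y - x| <= rho & G y = 0.
Proof.
move=> rho0 Gc Gx.
pose A := [set y : 'rV[R]_N | `|y - x| <= rho].
have Ax : A x by rewrite /A /= subrr normr0 ltW.
have Lip y y' : A y -> A y' -> `|G y - G y'| <= 2 * `|y - y'|.
  move=> Ay Ay'; have := ler_normD (G y - G y' - (y - y')) (y - y').
  by have := Gc _ _ Ay Ay'; have := normr_ge0 (y - y'); rewrite subrK; lra.
have Ac : compact A.
  apply: bounded_closed_compact.
    exists (`|x| + rho); split; first exact: num_real.
    move=> m ltm y Ay; have := ler_normD (y - x) x; rewrite subrK.
    by move: Ay; rewrite /A /=; lra.
  exact: (@closed_dist_le R 'rV[R]_N).
have [|y /set_mem Ay ymin] :=
    EVT_min_rV (f := fun y => `|G y|) (ex_intro _ x Ax) Ac.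
  apply/subspace_continuousP => y Ay; apply/cvgrPdist_lt => e e0.
  near=> u.
  have Au : A u by near: u; exact: withinT.
  have uy : `|u - y| < e / 2.
    near: u; apply: cvg_within; apply: (@near_ball R 'rV[R]_N).
    by rewrite divr_gt0.
  apply: le_lt_trans (ler_dist_dist _ _) _.
  by have := Lip _ _ Ay Au; rewrite [`|y - u|]distrC; lra.
have Gyx : `|G y| <= `|G x| by apply: ymin; rewrite inE.
have Gxy := Gc _ _ Ay Ax.
have yx : `|y - x| < rho / 2.
  have := ler_normD (y - x - (G y - G x)) (G y - G x); rewrite subrK.
  by have := ler_normB (G y) (G x); rewrite distrC in Gxy; lra.
exists y => //; apply/eqP; rewrite -normr_le0.
have Ay' : A (y - G y).
  rewrite /A /= addrAC; have := ler_normB (y - x) (G y); lra.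
have := Gc _ _ Ay' Ay.
rewrite [y - G y - y]addrAC subrr sub0r opprK subrK normrN => h.
have : `|G y| <= `|G (y - G y)| by apply: ymin; rewrite inE.
by move: h; have := normr_ge0 (G y); lra.
Unshelve. all: by end_near. Qed.

(** Only for a square system: the zero of the preconditioned system found
    near x has to be a solution. *)
Lemma implicit_function (U : set 'rV[R]_P) p :
  persistent_at (nonsing_isolated F) U p.
Proof.
move=> x [[Fx rJ] _] e e0.
have [B Binj [d d0 dP]] := values_preconditioned rJ.
have [d' d'0 d'P] := jacobian_unit_near rJ.
have [rho [rho0 rhod rhod' rhoe]] :
    exists rho, [/\ 0 < rho, rho < d, rho < d' & rho < e].
  near (0 : R)^'+ => rho; exists rho; split => //;
    by near: rho; exact: nbhs_right_lt.
have [D D0 BD] := mulmx_bounded B.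
have D1 : 0 < D + 1 by rewrite ltr_wpDl.
have eta0 : 0 < rho / 8 / (D + 1) by rewrite divr_gt0// divr_gt0.
have Fi i : \forall q \near p, `|peval (F i) x q| < rho / 8 / (D + 1).
  have [c c0 cP] := peval_near (F i) p x eta0.
  near=> q; have := cP q x; rewrite Fx subr0; apply.
    by near: q; exact: (@near_ball R 'rV[R]_P).
  by rewrite subrr normr0.
have Fsmall := filter_forall (nbhs_filter p) Fi.
near=> q => Uq.
have qp : `|q - p| < rho by near: q; exact: (@near_ball R 'rV[R]_P).
have [|||y yx Gy] :=
    @near_identity_zero (fun y => values F q y *m B) x rho => //.
- move=> y y' yx y'x; apply: dP; first exact: lt_trans rhod.
    exact: le_lt_trans rhod.
  exact: le_lt_trans rhod.
- apply: le_lt_trans (BD _) _.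
  have vq : `|values F q x| <= rho / 8 / (D + 1).
    apply: mx_norm_le => [|i j]; first exact: ltW.
    by rewrite mxE; apply: ltW; move: j; near: q.
  apply: le_lt_trans (ler_wpM2l D0 vq) _.
  by rewrite mulrA ltr_pdivrMr// mulrC ltr_pM2l ?divr_gt0// ltrDl.
have Fy : is_solution F q y by apply/solution_values/Binj.
have ns : nonsingular_solution F q y.
  split => //; apply: d'P; first exact: lt_trans rhod'.
  exact: le_lt_trans rhod'.
exists y; last exact: le_lt_trans rhoe.
by split => //; exact: nonsingular_isolated.
Unshelve. all: by end_near. Qed.

End ImplicitFunctionSquare.

(** * Persistence of solutions when every loop lifts *)

Section PathThroughSequence.
Variables (R : realType) (V : normedModType R).

Let a k : R := (2 ^+ k.+3)^-1.
(** The tents are supported on the disjoint intervals (3 a k, 5 a k), which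
    accumulate at 0. *)
Let tent k (t : R) : R := Num.max 0 (1 - `|t - 4 * a k| / a k).

Let a_gt0 k : 0 < a k. Proof. by rewrite invr_gt0 exprn_gt0. Qed.

Let a_half j k : (j < k)%N -> 2 * a k <= a j.
Proof.
move=> jk; have -> : a j = 2 * a j.+1.
  by rewrite /a [in RHS](exprS 2 j.+3); field; rewrite expf_neq0.
by rewrite ler_pM2l// lef_pV2 ?posrE ?exprn_gt0// ler_eXn2l ?ltr1n.
Qed.

Let a_le k : 8 * a k <= 1.
Proof.
rewrite /a ler_pdivrMr ?exprn_gt0// mul1r (_ : 8 = 2 ^+ 3 :> R).
  by rewrite ler_eXn2l// ltr1n.
by rewrite -natrX.
Qed.

Let tent_ge0 k t : 0 <= tent k t.
Proof. by rewrite /tent le_max lexx. Qed.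

Let tent_le1 k t : tent k t <= 1.
Proof. by rewrite ge_max ler01 gerBl divr_ge0// ltW. Qed.

Let tent_gt0 k t : 0 < tent k t -> 3 * a k < t < 5 * a k.
Proof.
rewrite lt_max ltxx /= subr_gt0 ltr_pdivrMr// mul1r ltr_norml.
by move=> /andP[? ?]; apply/andP; split; lra.
Qed.

Let tent_inj j k t : 0 < tent j t -> 0 < tent k t -> j = k.
Proof.
move=> /tent_gt0/andP[? ?] /tent_gt0/andP[? ?].
have := a_gt0 j; have := a_gt0 k.
by case: (ltngtP j k) => [/a_half h|/a_half h|//]; exfalso; lra.
Qed.

Let tent_eq0 k t : ~~ (0 < tent k t) -> tent k t = 0.
Proof. by rewrite -leNgt => h; apply/eqP; rewrite eq_le h tent_ge0. Qed.

Let tent_continuous k : continuous (tent k).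
Proof.
move=> t; apply: (@continuous_max R R (fun=> 0) (fun t => 1 - _)).
  exact: cvg_cst.
apply: cvgB; first exact: cvg_cst.
apply: cvgMr_tmp; apply: cvg_norm; apply: cvgB; [exact: cvg_id|exact: cvg_cst].
Qed.

(** The path rests at p except for an excursion along the segment from p to
    q k and back during the k-th interval. The excursions shrink to p, so
    that the path is a uniform limit of finite sums of tents. *)
Lemma path_through_sequence (p : V) (q : nat -> V) (e : R) : 0 < e ->
    (forall n, `|q n - p| <= e / n.+1%:R) ->
  exists c : R -> V, [/\ continuous c, forall t, `|c t - p| <= e,
    forall t, t <= 0 -> c t = p, forall t, 1 <= t -> c t = p &
    forall n, exists2 t, t \in `[0, 1] & c t = q n].
Proof.
move=> e0 qp.
pose c t := if pselect (exists k, 0 < tent k t) is left P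
  then p + tent (projT1 (cid P)) t *: (q (projT1 (cid P)) - p) else p.
have cE k t : 0 < tent k t -> c t = p + tent k t *: (q k - p).
  move=> kt; rewrite /c; case: pselect => [P|]; last by case; exists k.
  by case: cid => j /= jt; rewrite (tent_inj jt kt).
have cp t : (forall k, ~~ (0 < tent k t)) -> c t = p.
  move=> nt; rewrite /c; case: pselect => // P; exfalso.
  by case: P => k; exact/negP.
have en_le n k : (n <= k)%N -> e / k.+1%:R <= e / n.+1%:R.
  by move=> nk; rewrite ler_pM2l// lef_pV2 ?posrE// ler_nat.
have tent_dist k t : `|tent k t *: (q k - p)| <= e / k.+1%:R.
  by rewrite normrZ ger0_norm// (le_trans _ (qp k))// ler_piMl.
(* At most one tent is nonzero at t; only those of index at least n are
   neglected. *)
have approx n t :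
    `|c t - (p + \sum_(k < n) tent k t *: (q k - p))| <= e / n.+1%:R.
  have [[k kt]|nt] := pselect (exists k, 0 < tent k t); last first.
    have {}nt k : ~~ (0 < tent k t) by apply/negP => kt; apply: nt; exists k.
    rewrite cp// big1 => [|k _]; last by rewrite tent_eq0// scale0r.
    by rewrite addr0 subrr normr0 divr_ge0// ltW.
  have tent0 j : j != k -> tent j t *: (q j - p) = 0.
    move=> jk; rewrite tent_eq0 ?scale0r//; apply: contra jk => jt.
    by rewrite (tent_inj jt kt).
  rewrite (cE k t kt); have [kn|nk] := ltnP k n.
    rewrite (bigD1 (Ordinal kn))//= big1 => [|j jk]; last exact: tent0.
    by rewrite addr0 subrr normr0 divr_ge0// ltW.
  rewrite big1 => [|j _]; last first.
    by apply: tent0; rewrite neq_ltn (leq_trans (ltn_ord j) nk).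
  by rewrite addr0 addrC addKr (le_trans (tent_dist k t))// en_le.
exists c; split.
- have sc n : continuous (fun t => \sum_(k < n) tent k t *: (q k - p)).
    apply: continuous_big => [|k _ t]; first exact: add_continuous.
    by apply: cvgZr_tmp; exact: tent_continuous.
  move=> t; apply/cvgrPdist_lt => d d0.
  have [n en] : exists n, e / n.+1%:R < d / 3.
    by apply: exists_divn_lt; rewrite // divr_gt0.
  near=> u.
  have su : `|\sum_(k < n) tent k u *: (q k - p) -
      \sum_(k < n) tent k t *: (q k - p)| < d / 3.
    by near: u; apply: near_dist (sc n t) _; rewrite divr_gt0.
  move: (approx n t) (approx n u) su.
  set st := \sum_(k < n) tent k t *: _; set su := \sum_(k < n) tent k u *: _.
  move=> tn un stu; move: en tn un; move: (e / _) => y.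
  have := ler_distD (p + st) (c t) (c u).
  have := ler_distD (p + su) (p + st) (c u).
  have -> : p + st - (p + su) = st - su by rewrite opprD addrACA subrr add0r.
  rewrite [`|st - su|]distrC [`|p + su - c u|]distrC.
  lra.
- move=> t; have [[k kt]|nt] := pselect (exists k, 0 < tent k t).
    rewrite (cE k)// addrC addKr (le_trans (tent_dist k t))//.
    by rewrite ler_pdivrMr// ler_peMr ?ler1n// ltW.
  rewrite cp ?subrr ?normr0 ?ltW// => k.
  by apply/negP => kt; apply: nt; exists k.
- move=> t t0; apply: cp => k; apply/negP => /tent_gt0.
  by have := a_gt0 k; lra.
- move=> t t1; apply: cp => k; apply/negP => /tent_gt0.
  by have := a_gt0 k; have := a_le k; lra.
- move=> n; have tn1 : tent n (4 * a n) = 1.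
    by rewrite /tent subrr normr0 mul0r subr0 max_r.
  exists (4 * a n); last by rewrite (cE n) tn1 ?ltr01// scale1r addrC subrK.
  by rewrite in_itv /=; have := a_gt0 n; have := a_le n; lra.
Unshelve. all: by end_near. Qed.

End PathThroughSequence.

(** A sequence of parameters tending to p, over which the solution y fails
    to persist, would lie with p on one loop; but the r lifts of this loop
    force y to persist along its image. *)
Lemma loops_persistent (R : realType) (X Y : normedModType R) (S : X -> set Y)
    (U : set X) (b : X) (r : nat) (x : 'I_r -> Y) :
    (forall p x, S p x -> exists2 e, 0 < e & separates S p x e) ->
    open U -> connected U -> U b ->
    (forall p, U p -> (S p #= `I_r)%card) -> injective x ->
    (forall g, path_from_to U b b g ->
      forall i, exists2 z, is_lift S g z & z 0 = x i) ->
  forall p, U p -> persistent_at S U p.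
Proof.
move=> Sunr Uo Uc Ub Ur xinj loops p Up y Spy e e0; apply: contrapT => nper.
have [d [d0 dU]] : exists d, 0 < d /\ forall v, `|v - p| <= d -> U v.
  have /nbhs_normP[d /= d0 dU] : nbhs p U by exact: open_nbhs_nbhs.
  exists (d / 2); split=> [|v vp]; first by rewrite divr_gt0.
  by apply: dU; rewrite /= distrC; lra.
have /choice[q qP] : forall n, exists q, [/\ `|q - p| <= d / n.+1%:R, U q &
    ~ exists2 y', S q y' & `|y' - y| < e].
  move=> n; apply: contrapT => nq; apply: nper.
  have dn0 : 0 < d / n.+1%:R by rewrite divr_gt0.
  near=> q => Uq; apply: contrapT => nS; apply: nq; exists q.
  have qp : `|q - p| < d / n.+1%:R by near: q; exact: near_ball.
  by split; [exact: ltW| |].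
have qd n : `|q n - p| <= d / n.+1%:R by case: (qP n).
(* The loop l goes from b to p, runs through the sequence and returns to p,
   then goes back to b. *)
have [c [cc cd c0 c1 cq]] := path_through_sequence d0 qd.
have [g gP] := open_connected_path Uo Uc Ub Up.
have cP : path_from_to U p p c by split => // t; exact: dU.
have [gcP _ gc2] := concat_path gP cP.
have [lP l1 _] := concat_path gcP (rev_path gP).
set l := concat _ _ _ in lP l1.
have /choice[z zP] : forall i, exists z, is_lift S l z /\ z 0 = x i.
  by move=> i; have [z] := loops _ lP i; exists z.
have [lc lU _ _] := lP.
have zinj : injective (fun i => z i 0).
  by move=> i j; rewrite (zP i).2 (zP j).2; exact: xinj.
have := lifts_persistent Sunr lc (fun i => (zP i).1) (fun t => Ur _ (lU t))
  zinj Spy e0.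
move=> /nbhs_normP[m /= m0 mP].
have [n nm] : exists n, d / n.+1%:R < m by exact: exists_divn_lt.
have [_ _ []] := qP n; apply: mP.
  by rewrite /= distrC (le_lt_trans (qd n)).
have [t t01 <-] := cq n; move: t01; rewrite in_itv /= => /andP[t0 t1].
(* The second half of the first half of l is the path c. *)
exists ((t + 1) / 2 / 2); first by rewrite /= in_itv /=; lra.
by rewrite l1 ?gc2//; lra.
Unshelve. all: by end_near. Qed.

(** * The real monodromy group *)

Section RealMonodromy.
Variables (R : realType) (M N P r : nat) (F : poly_system R M N P).
Variables (b : 'rV[R]_P) (x : 'I_r -> 'rV[R]_N) (U : set 'rV[R]_P).
Hypothesis x_inj : injective x.
Hypothesis x_sols : range x = nonsing_isolated F b.
Hypothesis U_count : forall p, U p -> (nonsing_isolated F p #= `I_r)%card.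

Let S := nonsing_isolated F.

Lemma solution_path_lift (g : R -> 'rV[R]_P) (z : R -> 'rV[R]_N) :
  solution_path F g z ->
  is_lift S (fun t => g (clamp t)) (fun t => z (clamp t)).
Proof.
move=> [zc zS]; split; first exact: clamp_compose.
by move=> t; apply: zS; exact: clamp_itv.
Qed.

(** The compact set K that carries the homotopy may be smaller than U: for
    one parameter, persistence is only known on the image of the loop. *)
Lemma generates_nullhomotopic (K : set 'rV[R]_P) (H : R * R -> 'rV[R]_P)
    (g : R -> 'rV[R]_P) (s : 'S_r) :
    compact K -> K `<=` U -> (forall p, K p -> persistent_at S K p) ->
    continuous H -> (forall st, K (H st)) ->
    (forall s t, H (s, clamp t) = H (s, t)) ->
    (forall t, H (0, t) = g (clamp t)) -> (forall t, H (1, t) = b) ->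
    (forall s, H (s, 0) = b) -> (forall s, H (s, 1) = b) ->
    generates F x g s ->
  s = 1%g.
Proof.
move=> Kc KU Kper Hc KH Hclamp H0 H1 Hs0 Hs1 gen.
apply/permP => i; rewrite perm1; apply: x_inj.
have [z [/solution_path_lift zl z0 z1]] := gen i.
have := lift_homotopy (@nonsing_isolated_separates _ _ _ _ F) Kc
  (fun p Kp => U_count (KU p Kp)) Kper Hc KH Hclamp H1 Hs0 Hs1.
move=> /(_ (fun t => z (clamp t))); rewrite clamp0 clamp1 z0 z1 => -> //.
by rewrite (_ : (fun t => H (0, t)) = fun t => g (clamp t)) //; exact/funext.
Qed.

Lemma generates_cst : generates F x (fun=> b) 1%g.
Proof.
move=> i; exists (fun=> x i); rewrite perm1; split=> //; split.
  by apply: continuous_subspaceT => t; exact: cvg_cst.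
by move=> t _; rewrite -x_sols; exists i.
Qed.

Lemma is_loop_cst : U b -> is_loop U b (fun=> b).
Proof.
by move=> Ub; split=> //; apply: continuous_subspaceT => t; exact: cvg_cst.
Qed.

(** The constant loop belongs to its own class, which by triviality is the
    class of g. *)
Lemma loop_nullhomotopic g : U b -> trivial_fundamental_group U b ->
  is_loop U b g -> loop_homotopic U b g (fun=> b).
Proof.
move=> Ub triv gl.
have : fundamental_group U b (homotopy_class U b g) by exists g.
rewrite triv => gE.
have : homotopy_class U b (fun=> b) (fun=> b).
  split; first exact: is_loop_cst.
  exists (fun=> b); split=> //.
  by apply: continuous_subspaceT => t; exact: cvg_cst.
by rewrite -gE => -[].
Qed.

(** The solution paths that define the permutation generated by a loop are
    the lifts required for persistence. *)
Lemma every_loop_generates_persistent : open U -> connected U -> U b ->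
  every_loop_generates F U b x -> forall p, U p -> persistent_at S U p.
Proof.
move=> Uo Uc Ub loops.
apply: (loops_persistent (@nonsing_isolated_separates _ _ _ _ F) Uo Uc Ub
  U_count x_inj) => g [gc gU g0 g1] i.
have [|s /(_ i)[z [zp z0 _]]] := loops g.
  split=> //; [exact: continuous_subspaceT|exact: g0|exact: g1].
exists (fun t => z (clamp t)); last by rewrite clamp0.
have := solution_path_lift zp; congr (is_lift _ _ _); apply/funext => t.
have [t0|t0] := leP t 0; first by rewrite clamp_le0// !g0.
have [t1|t1] := leP 1 t; first by rewrite clamp_ge1// !g1.
by rewrite clamp_id// in_itv /= !ltW.
Qed.

Lemma simply_connected_monodromy g s : U b -> trivial_fundamental_group U b ->
    (forall p, U p -> persistent_at S U p) ->
    is_loop U b g -> generates F x g s ->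
  s = 1%g.
Proof.
move=> Ub triv Uper gl gen.
have [H [Hc HU H01 Hb]] := loop_nullhomotopic Ub triv gl.
pose Hcl st := H (clamp st.1, clamp st.2).
have Hclc : continuous Hcl by exact: clamp_square_compose.
pose K := Hcl @` (`[0, 1]%classic `*` `[0, 1]%classic).
have KU : K `<=` U by move=> _ [st _ <-]; apply: HU; exact: clamp_itv.
apply: (@generates_nullhomotopic K Hcl g s) => //.
- apply: continuous_compact; first exact: continuous_subspaceT.
  by apply: compact_setX; exact: segment_compact.
- by move=> p Kp; exact: (persistent_subset KU (Uper p (KU p Kp))).
- move=> st; exists (clamp st.1, clamp st.2); first by split; exact: clamp_itv.
  by rewrite /Hcl /= !clampK.
- by move=> s' t; rewrite /Hcl /= clampK.
- by move=> t; rewrite /Hcl /= clamp0 (H01 _ (clamp_itv t)).1.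
- by move=> t; rewrite /Hcl /= clamp1 (H01 _ (clamp_itv t)).2.
- by move=> s'; rewrite /Hcl /= clamp0 (Hb _ (clamp_itv s')).1.
- by move=> s'; rewrite /Hcl /= clamp1 (Hb _ (clamp_itv s')).2.
Qed.

End RealMonodromy.

(** By the intermediate value theorem the image of a path in a line is an
    interval; this is where dimension one enters. *)
Lemma rV1_path_convex (R : realType) (g : R -> 'rV[R]_1) (s t : R) :
  continuous g -> s \in `[0, 1] -> 0 <= t ->
  exists2 u, 0 <= u <= t & g u = g t + s *: (g 0 - g t).
Proof.
rewrite in_itv /= => gc /andP[s0 s1] t0.
have fc : continuous (fun u => g u 0 0).
  move=> u; apply: (@continuous_comp _ _ _ g (fun A : 'rV[R]_1 => A 0 0)).
    exact: gc.
  exact: coord_continuous.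
have [||u] :=
    @IVT R (fun u => g u 0 0) 0 t (g t 0 0 + s * (g 0 0 0 - g t 0 0)) t0.
- exact: continuous_subspaceT.
- have [gt|/ltW gt] := leP (g 0 0 0) (g t 0 0).
    by apply/andP; split; nra.
  by apply/andP; split; nra.
rewrite in_itv /= => ut gu; exists u => //.
by apply/rowP => i; rewrite ord1 gu !mxE.
Qed.

(** The lifts along the loop itself make solutions persist over its image,
    and the linear contraction to b does not leave this image. *)
Lemma line_monodromy (R : realType) (M N r : nat) (F : poly_system R M N 1)
    (b : 'rV[R]_1) (x : 'I_r -> 'rV[R]_N) (U : set 'rV[R]_1)
    (g : R -> 'rV[R]_1) (s : 'S_r) :
    injective x -> (forall p, U p -> (nonsing_isolated F p #= `I_r)%card) ->
    is_loop U b g -> generates F x g s ->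
  s = 1%g.
Proof.
move=> xinj Ur [gc gU g0 g1] gen.
pose h t := g (clamp t).
have hc : continuous h by exact: clamp_compose.
have h0 : h 0 = b by rewrite /h clamp0.
have h1 : h 1 = b by rewrite /h clamp1.
have hclamp t : h (clamp t) = h t by rewrite /h clampK.
have hU t : U (h t) by apply: gU; exact: clamp_itv.
pose K := h @` `[0, 1]%classic.
have KU : K `<=` U by move=> _ [t _ <-].
have /choice[z zP] : forall i, exists z,
    is_lift (nonsing_isolated F) h z /\ z 0 = x i.
  move=> i; have [z [/solution_path_lift zl z0 _]] := gen i.
  by exists (fun t => z (clamp t)); rewrite clamp0.
have zinj : injective (fun i => z i 0).
  by move=> i j; rewrite (zP i).2 (zP j).2; exact: xinj.
have Kper p : persistent_at (nonsing_isolated F) K p.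
  exact: (lifts_persistent (@nonsing_isolated_separates _ _ _ _ F) hc
    (fun i => (zP i).1) (fun t => Ur _ (hU t)) zinj).
pose H st := h st.2 + clamp st.1 *: (b - h st.2).
apply: (@generates_nullhomotopic _ _ _ _ _ F b x U xinj Ur K H g s) => //.
- apply: continuous_compact; first exact: continuous_subspaceT.
  exact: segment_compact.
- have h2 : continuous (fun st : R * R => h st.2).
    by apply: continuous_compose hc => st; exact: cvg_snd.
  have c1 : continuous (fun st : R * R => clamp st.1).
    by apply: continuous_compose (@clamp_continuous R) => st; exact: cvg_fst.
  move=> st; apply: cvgD; first exact: h2.
  by apply: cvgZ; [exact: c1|apply: cvgB; [exact: cvg_cst|exact: h2]].
- move=> [s' t]; rewrite /H /= -h0 -hclamp.
  have := clamp_itv t; rewrite in_itv /= => /andP[t0 t1].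
  have [u /andP[u0 ut] <-] := rV1_path_convex hc (clamp_itv s') t0.
  by exists u => //=; rewrite in_itv /= u0 (le_trans ut).
- by move=> s' t; rewrite /H /= hclamp.
- by move=> t; rewrite /H /= clamp0 scale0r addr0.
- by move=> t; rewrite /H /= clamp1 scale1r addrC subrK.
- by move=> s'; rewrite /H /= h0 subrr scaler0 addr0.
- by move=> s'; rewrite /H /= h1 subrr scaler0 addr0.
Qed.

Theorem theorem3p3 (R : realType) (M N P r : nat) (F : poly_system R M N P)
    (b : 'rV[R]_P) (x : 'I_r -> 'rV[R]_N) (U : set 'rV[R]_P)
    (r_gt0 : (0 < r)%N)
    (x_inj : injective x) (x_sols : range x = nonsing_isolated F b)
    (U_open : open U) (U_connected : connected U) (Ub : U b)
    (U_count : forall p, U p -> (nonsing_isolated F p #= `I_r)%card) :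
  (trivial_fundamental_group U b ->
   ((N < M)%N -> every_loop_generates F U b x) ->
   real_monodromy_group F U b x = [set 1%g]) /\
  (P = 1%N -> real_monodromy_group F U b x = [set 1%g]).
Proof.
have id_in : [set 1%g] `<=` real_monodromy_group F U b x.
  move=> _ ->; exists (fun=> b).
  by split; [exact: is_loop_cst|exact: generates_cst].
have NM : (N <= M)%N.
  have [[_ rJ] _] : nonsing_isolated F b (x (Ordinal r_gt0)).
    by rewrite -x_sols; exists (Ordinal r_gt0).
  by rewrite -[N]rJ rank_leq_row.
split=> [triv loops|P1]; (apply/seteqP; split=> // s [g [gl gen]]); rewrite /=.
  apply: (simply_connected_monodromy x_inj U_count Ub triv _ gl gen).
  have [MN|MN] := ltnP N M.
    exact: (every_loop_generates_persistent x_inj U_count U_open U_connected Ub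
      (loops MN)).
  have {NM MN}MN : N = M by apply/eqP; rewrite eqn_leq NM MN.
  by subst N => p _; exact: implicit_function.
by subst P; exact: (line_monodromy x_inj U_count gl gen).
Qed.
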